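(* Let $(R,m)$ be a complete local normal domain of dimension $n$, and let $R\hookrightarrow A$ be an integral extension such that $A$ is an integral domain and $Q(R)\hookrightarrow Q(A)$ is a separable algebraic extension. Then $H_m^n(\Omega_{A/R})=0$.
   Context: $Q(-)$ denotes the field of fractions; $\Omega_{A/R}$ denotes the module of Kähler differentials of $A$ over $R$; $H^i_m(-)$ is local cohomology with support in $m$. Local rings $(R,m)$ are Noetherian; $A$ need not be. *)

(* Defs.v *)
(* Ideals are collective predicates [{pred R}], as in [ring_quotient]; note
   that [idealr_closed] there means PROPER ideal. *)
From HB Require Import structures.
From mathcomp Require Import all_boot all_order all_algebra all_field.
From mathcomp Require Import generic_quotient ring_quotient fraction.

Set Implicit Arguments.
Unset Strict Implicit.
Unset Printing Implicit Defensive.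

Import GRing.Theory.
Local Open Scope ring_scope.

Section LocalRings.
Variable R : comNzRingType.
Implicit Types I J m : {pred R}.

(* The improper ideal is generated by 1, so only proper ideals are tested. *)
Definition noetherian : Prop :=
  forall I, idealr_closed I ->
  exists s : seq R, {subset s <= I} /\
    forall x, x \in I -> exists c : 'I_(size s) -> R,
      x = \sum_(i < size s) c i * s`_i.

Definition maximal_ideal m : Prop :=
  idealr_closed m /\
  forall J, idealr_closed J -> {subset m <= J} -> J =i m.

Definition local_ring m : Prop :=
  [/\ noetherian, maximal_ideal m
    & forall m', maximal_ideal m' -> m' =i m].

Definition prime_ideal (P : {pred R}) : Prop := idealr_closed P /\ prime_idealr_closed P.

(* Strictly increasing chains P 0 < ... < P n; the values P i for i > n are
   irrelevant. *)
Definition prime_chain (n : nat) (P : nat -> {pred R}) : Prop :=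
  (forall i, (i <= n)%N -> prime_ideal (P i)) /\
  (forall i, (i < n)%N ->
     {subset P i <= P i.+1} /\ exists2 x, x \in P i.+1 & x \notin P i).

Definition has_krull_dim (n : nat) : Prop :=
  (exists P, prime_chain n P) /\
  (forall k P, prime_chain k P -> (k <= n)%N).

(* The coefficients c make the 0-th power the whole ring. *)
Definition in_ideal_pow m (k : nat) (x : R) : Prop :=
  exists (N : nat) (c : 'I_N -> R) (y : 'I_N -> 'I_k -> R),
    (forall i j, y i j \in m) /\ x = \sum_(i < N) c i * \prod_(j < k) y i j.

(* Injectivity and surjectivity of R -> lim_k R / m^k, an element of the limit
   being represented by a coherent sequence of lifts u k of its components. *)
Definition adically_complete m : Prop :=
  (forall x, (forall k, in_ideal_pow m k x) -> x = 0) /\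
  (forall u : nat -> R, (forall k, in_ideal_pow m k (u k.+1 - u k)) ->
     exists l, forall k, in_ideal_pow m k (l - u k)).

End LocalRings.

Section FractionFields.

Definition normal_domain (R : idomainType) : Prop :=
  forall x : {fraction R}, integralOver (@FracField.tofrac R) x ->
  exists r : R, x = FracField.tofrac r.

Definition separable_algebraic (K L : fieldType) (iota : {rmorphism K -> L}) :
    Prop :=
  forall x : L, exists p : {poly K},
    [/\ irreducible_poly p, separable_poly p & root (map_poly iota p) x].

Variables (R A : idomainType) (f : {rmorphism R -> A}).
Local Notation "x %:F" := (FracField.tofrac x).

(* The map Q(R) -> Q(A) induced by an injective f. *)
Definition frac_map (f_inj : injective f) (x : {fraction R}) : {fraction A} :=
  (f \n_(repr x))%:F / (f \d_(repr x))%:F.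

Lemma frac_repr (x : {fraction R}) : x = (\n_(repr x))%:F / (\d_(repr x))%:F.
Proof.
have d0 : (\d_(repr x))%:F != 0 by rewrite tofrac_eq0 denom_ratioP.
apply: (mulIf d0); rewrite divfK // -{1}[x]reprK.
unlock FracField.tofrac; rewrite -[LHS]FracField.pi_mul.
apply/eqmodP; rewrite /= FracField.equivfE /FracField.mulf /=.
by rewrite !numden_Ratio ?(mulf_neq0, oner_neq0, denom_ratioP) ?mulr1 // mulrC.
Qed.

Hypothesis f_inj : injective f.

Lemma frac_map_div (a b : R) : b != 0 ->
  frac_map f_inj (a%:F / b%:F) = (f a)%:F / (f b)%:F.
Proof.
move=> b0; rewrite /frac_map; set x : {fraction R} := a%:F / b%:F.
have d0 := denom_ratioP (repr x).
have fb0 c : c != 0 -> (f c)%:F != 0.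
  by move=> c0; rewrite tofrac_eq0 -(rmorph0 f) (inj_eq f_inj).
have := frac_repr x; rewrite {1}/x => /eqP.
rewrite eqr_div ?tofrac_eq0 // -!tofracM tofrac_eq => /eqP e.
apply/eqP; rewrite eqr_div ?fb0 // -!tofracM -!rmorphM.
by rewrite e.
Qed.

Lemma frac_map_tofrac (a : R) : frac_map f_inj a%:F = (f a)%:F.
Proof.
by have := @frac_map_div a 1 (oner_neq0 _); rewrite rmorph1 !tofrac1 !divr1.
Qed.

Lemma frac_map_is_zmod_morphism : zmod_morphism (frac_map f_inj).
Proof.
move=> x y; rewrite {1}[x]frac_repr {1}[y]frac_repr.
have dx := denom_ratioP (repr x); have dy := denom_ratioP (repr y).
rewrite -mulNr addf_div ?tofrac_eq0 // mulNr -!tofracM -tofracB.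
rewrite frac_map_div ?mulf_neq0 //.
rewrite /frac_map -[in RHS]mulNr addf_div; last 2 first.
- by rewrite tofrac_eq0 -(rmorph0 f) (inj_eq f_inj).
- by rewrite tofrac_eq0 -(rmorph0 f) (inj_eq f_inj).
by rewrite mulNr -!tofracM -tofracB rmorphB !rmorphM.
Qed.

Lemma frac_map_is_monoid_morphism : monoid_morphism (frac_map f_inj).
Proof.
split; first by rewrite -(tofrac1 R) frac_map_tofrac rmorph1 tofrac1.
move=> x y; rewrite {1}[x]frac_repr {1}[y]frac_repr.
have dx := denom_ratioP (repr x); have dy := denom_ratioP (repr y).
rewrite mulf_div -!tofracM frac_map_div ?mulf_neq0 //.
by rewrite /frac_map mulf_div -!tofracM !rmorphM.
Qed.

HB.instance Definition _ :=
  GRing.isZmodMorphism.Build {fraction R} {fraction A} (frac_map f_inj)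
    frac_map_is_zmod_morphism.
HB.instance Definition _ :=
  GRing.isMonoidMorphism.Build {fraction R} {fraction A} (frac_map f_inj)
    frac_map_is_monoid_morphism.

End FractionFields.

(* An A-module M seen as an R-module through phi. *)
Definition restrict_scalars (R A : comNzRingType) (phi : {rmorphism R -> A})
  (M : lmodType A) : Type := M.

Section RestrictScalars.
Variables (R A : comNzRingType) (phi : {rmorphism R -> A}) (M : lmodType A).

HB.instance Definition _ := GRing.Zmodule.on (restrict_scalars phi M).

Definition rs_scale (r : R) (x : restrict_scalars phi M) :
    restrict_scalars phi M :=
  phi r *: (x : M).

Fact rs_scaleA a b v : rs_scale a (rs_scale b v) = rs_scale (a * b) v.
Proof. by rewrite /rs_scale scalerA rmorphM. Qed.
Fact rs_scale1 : left_id 1 rs_scale.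
Proof. by move=> v; rewrite /rs_scale rmorph1 scale1r. Qed.
Fact rs_scaleDr : right_distributive rs_scale +%R.
Proof. by move=> a u v; rewrite /rs_scale scalerDr. Qed.
Fact rs_scaleDl v : {morph rs_scale^~ v : a b / a + b}.
Proof. by move=> a b; rewrite /rs_scale rmorphD scalerDl. Qed.

HB.instance Definition _ :=
  GRing.Zmodule_isLmodule.Build R (restrict_scalars phi M)
    rs_scaleA rs_scale1 rs_scaleDr rs_scaleDl.

End RestrictScalars.

Section Kaehler.
Variables (R A : comNzRingType) (phi : {rmorphism R -> A}).

Definition derivation (M : lmodType A) (d : A -> M) : Prop :=
  [/\ forall a b, d (a + b) = d a + d b,
      forall a b, d (a * b) = a *: d b + b *: d a
    & forall r, d (phi r) = 0].

(* (M, d) is a module of Kaehler differentials of A over R: the universal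
   R-linear derivation out of A. *)
Definition kaehler_differentials (M : lmodType A) (d : A -> M) : Prop :=
  derivation d /\
  forall (N : lmodType A) (D : A -> N), derivation D ->
    exists g : {linear M -> N},
      (forall a, g (d a) = D a) /\
      forall h : {linear M -> N}, (forall a, h (d a) = D a) -> h =1 g.

End Kaehler.

Section LocalCohomology.
Variable R : comNzRingType.

Definition injective_module (E : lmodType R) : Prop :=
  forall (U V : lmodType R) (i : {linear U -> V}) (f : {linear U -> E}),
    injective i -> exists g : {linear V -> E}, forall u, g (i u) = f u.

Record injective_resolution (M : lmodType R) := InjectiveResolution {
  res_mod : nat -> lmodType R;
  res_aug : {linear M -> res_mod 0%N};
  res_diff : forall i, {linear res_mod i -> res_mod i.+1};
  res_injective : forall i, injective_module (res_mod i);
  res_aug_inj : injective res_aug;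
  res_exact0 : forall x, res_diff 0 x = 0 <-> exists y, x = res_aug y;
  res_exactS : forall i x,
    res_diff i.+1 x = 0 <-> exists y, x = res_diff i y
}.

(* The section functor Gamma_m with support in m. *)
Definition in_Gamma (m : {pred R}) (M : lmodType R) (x : M) : Prop :=
  exists k : nat, forall a, in_ideal_pow m k a -> a *: x = 0.

(* H^i (Gamma_m (I)) = 0: the i-cocycles of the complex Gamma_m (I) are
   coboundaries. *)
Definition Gamma_cohomology_eq0 (m : {pred R}) (M : lmodType R)
    (I : injective_resolution M) (i : nat) : Prop :=
  forall x : res_mod I i, in_Gamma m x -> res_diff I i x = 0 ->
  match i return res_mod I i -> Prop with
  | 0 => fun x => x = 0
  | j.+1 => fun x => exists2 y, in_Gamma m y & x = res_diff I j y
  end x.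

(* H^i_m(M) = 0, where H^i_m is the i-th right derived functor of Gamma_m.
   Injective resolutions of M exist and H^i_m(M) does not depend, up to
   isomorphism, on the one that computes it, so the choice of I is immaterial. *)
Definition local_cohomology_eq0 (m : {pred R}) (i : nat) (M : lmodType R) :
    Prop :=
  forall I : injective_resolution M, Gamma_cohomology_eq0 m I i.

End LocalCohomology.

(* Main.v *)
From HB Require Import structures.
Require Import Defs.
From mathcomp Require Import all_boot all_order all_algebra all_field.
From mathcomp Require Import ring_quotient fraction boolp.
From Stdlib Require List.

Set Implicit Arguments.
Unset Strict Implicit.
Unset Printing Implicit Defensive.

Import GRing.Theory.
Local Open Scope ring_scope.

(** The module Omega is torsion over R, and the top local cohomology of a
    torsion module over a Noetherian local domain vanishes.

    Torsion ([kaehler_torsion]). By separability each a in A is a root of some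
    polynomial q over R with q'(a) <> 0, and applying d to q(a) = 0 gives
    q'(a) da = 0. As A is integral over R, the nonzero element q'(a) has a
    nonzero multiple in R, so da is torsion. Thus d takes its values in the
    torsion submodule of Omega, and the universal property makes this submodule
    all of Omega.

    Vanishing ([torsion_top_cohomology_eq0]). This is Grothendieck's vanishing
    theorem for modules of dimension smaller than n = dim R. Let I be an
    injective resolution of a torsion module M, and call Gamma_k the functor of
    the sections z with dim R / ann z < k. Then Gamma_n is the functor of
    torsion elements, and over a local ring Gamma_1 is the functor of sections
    with support in m. By descending induction on k the complex Gamma_k (I) is
    exact in all degrees at least n - k + 1 (and at least 1); for k = 1 and
    n > 0 this includes degree n.

    - For k = n, write a torsion cocycle z as d y. If r z = 0 with r <> 0, then
      r y is a cocycle, hence r y = d w unless y has degree 0. By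
      injectivity w = r w' up to r-torsion ([injective_divide_up_to_torsion]), and
      y - d w' is a torsion element with the same image z. If y has degree 0,
      then r y comes from the torsion module M.
    - For the step from k + 1 to k ([supported_cohomology_step]), write a
      cocycle z of Gamma_k as d y with y in Gamma_(k+1). Only finitely many
      primes P over ann y have dim R / P = k; call them bad. By prime
      avoidance some x outside the bad primes kills z, so that x y is a cocycle, x y = d w with w in
      Gamma_(k+1). Dividing w by x up to x-torsion gives w', and y - d w' is
      killed by a power of x, which removes the bad primes over ann y. The
      division must not introduce new bad primes coming from ann w; so w is
      first multiplied by some b, outside the bad primes of ann y, that removes
      all the other primes of coheight k over ann w. *)

(** * Submodules and injective modules *)

(** The proof of closure is a parameter, so that a submodule structure is
    available for predicates met in the middle of a proof. *)
Section Submodule.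
Variables (R : nzRingType) (V : lmodType R) (S : {pred V}).
Hypothesis S_closed : GRing.submod_closed S.

Definition closed_pred (_ : GRing.submod_closed S) : {pred V} := S.

HB.instance Definition _ :=
  GRing.isSubmodClosed.Build R V (closed_pred S_closed) S_closed.

Record submodule := Submodule {
  submodule_val : V;
  submodule_valP : submodule_val \in closed_pred S_closed }.

HB.instance Definition _ := [isSub for submodule_val].
HB.instance Definition _ := [Choice of submodule by <:].
HB.instance Definition _ := [SubChoice_isSubLmodule of submodule by <:].


End Submodule.
Section InjectiveExtension.
Variables (R : comNzRingType) (E : lmodType R).
Hypothesis E_inj : injective_module E.

(** Half of Baer's criterion: a linear map from an ideal to an injective module
    is the multiplication by an element. The map is given by its graph G, a
    submodule of R * E that is single-valued at 0; the first projection of G is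
    then injective, and the second one extends along it. *)
Lemma injective_extend_graph (G : R^o * E -> Prop) :
    G (0, 0) ->
    (forall a u v, G u -> G v -> G (a *: u + v)) ->
    (forall e, G (0, e) -> e = 0) ->
  exists e', forall a e, G (a, e) -> e = a *: e'.
Proof.
move=> G0 GD Gfun.
have Gc : GRing.submod_closed (V := (R^o * E)%type) [pred u | `[< G u >]].
  split=> [|a u v]; first by rewrite inE; apply/asboolP.
  by rewrite !inE => /asboolP Gu /asboolP Gv; apply/asboolP/GD.
pose U : lmodType R := submodule Gc.
have p_lin : linear (fun u : U => (val u).1 : R^o).
  by move=> a u v; rewrite (linearP (val : submodule Gc -> _)).
have q_lin : linear (fun u : U => (val u).2).
  by move=> a u v; rewrite (linearP (val : submodule Gc -> _)).
pose pM := GRing.isLinear.Build R U R^o *:%R _ p_lin.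
pose p : {linear U -> R^o} := HB.pack (fun u : U => (val u).1 : R^o) pM.
pose qM := GRing.isLinear.Build R U E *:%R _ q_lin.
pose q : {linear U -> E} := HB.pack (fun u : U => (val u).2) qM.
have GU (u : U) : G (val u) by apply/asboolP/(valP u).
have p_inj : injective p.
  move=> u v; rewrite -[p u]/(val u).1 -[p v]/(val v).1 => puv; apply: val_inj.
  have := GD (-1) _ _ (GU u) (GU v).
  case: (val u) puv => a e; case: (val v) => b f /= ->.
  rewrite scaleN1r addrC; rewrite -[X in G X]/(b - b, f - e) subrr => /Gfun /eqP.
  by rewrite subr_eq0 => /eqP ->.
have [g gE] := @E_inj U R^o p q p_inj.
exists (g 1) => a e Gae.
have GaeU : (a, e) \in closed_pred Gc by rewrite inE; apply/asboolP.
have /= := gE (Submodule GaeU); rewrite -linearZ => <-.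
by rewrite /= /GRing.scale /= mulr1.
Qed.
End InjectiveExtension.

(** * Primes of a Noetherian ring *)

Section Primes.
Variable R : comNzRingType.
Implicit Types I J P Q : {pred R}.

(** Ideals that may be improper, as annihilators and sums of ideals are. *)
Definition ideal_closed J : Prop :=
  0 \in J /\ forall a, {in J &, forall u v, a * u + v \in J}.

Lemma ideal_closedZ J a u : ideal_closed J -> u \in J -> a * u \in J.
Proof. by case=> J0 JD Ju; rewrite -[a * u]addr0 JD. Qed.

Lemma ideal_closedD J u v : ideal_closed J -> u \in J -> v \in J -> u + v \in J.
Proof. by case=> _ JD Ju Jv; rewrite -[u]mul1r JD. Qed.

Lemma proper_ideal_closed J : idealr_closed J -> ideal_closed J.
Proof. by case. Qed.

Lemma idealr_closedE J : ideal_closed J -> 1 \notin J -> idealr_closed J.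
Proof. by case=> J0 JD J1; split. Qed.

Lemma prime_ideal_closed P : prime_ideal P -> ideal_closed P.
Proof. by case=> /proper_ideal_closed. Qed.

Lemma prime_idealM P u v :
  prime_ideal P -> u \notin P -> v \notin P -> u * v \notin P.
Proof.
by move=> [_ Pp] uP vP; apply/negP => /Pp; rewrite (negPf uP) (negPf vP).
Qed.

Lemma prime_idealX P u k : prime_ideal P -> u ^+ k \in P -> u \in P.
Proof.
move=> PP; apply: contraTT => uP; elim: k => [|k IHk].
  by case: PP => -[].
by rewrite exprS prime_idealM.
Qed.

Definition adjoin J x : {pred R} :=
  [pred y | `[< exists2 j, j \in J & exists r, y = j + r * x >]].

Lemma adjoinP J x y :
  reflect (exists2 j, j \in J & exists r, y = j + r * x) (y \in adjoin J x).
Proof. exact: asboolP. Qed.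

Lemma adjoin_ideal J x : ideal_closed J -> ideal_closed (adjoin J x).
Proof.
move=> Jc; have [J0 JD] := Jc; split.
  by apply/adjoinP; exists 0 => //; exists 0; rewrite mul0r addr0.
move=> a _ _ /adjoinP[j Jj [r ->]] /adjoinP[k Jk [s ->]].
apply/adjoinP; exists (a * j + k); first exact: JD.
by exists (a * r + s); rewrite mulrDr mulrDl mulrA addrACA.
Qed.

Lemma sub_adjoin J x : {subset J <= adjoin J x}.
Proof.
by move=> j Jj; apply/adjoinP; exists j => //; exists 0; rewrite mul0r addr0.
Qed.

Lemma mem_adjoin J x : 0 \in J -> x \in adjoin J x.
Proof. by move=> J0; apply/adjoinP; exists 0 => //; exists 1; rewrite mul1r add0r. Qed.

(** Without a maximal element there is a strictly increasing sequence of members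
    of F. Its union is a proper ideal, and its finitely many generators all
    lie in one term of the sequence, which is then the last one. *)
Lemma noetherian_maximal (F : {pred R} -> Prop) J0 :
    noetherian R -> (forall J, F J -> idealr_closed J) -> F J0 ->
  exists J, [/\ F J, {subset J0 <= J}
    & forall J', F J' -> {subset J <= J'} -> {subset J' <= J}].
Proof.
move=> noeth Fid FJ0; apply: contrapT => noMax.
pose T := {J | F J /\ {subset J0 <= J}}.
have next (J : T) : exists J' : T,
    {subset sval J <= sval J'} /\ exists2 x, x \in sval J' & x \notin sval J.
  case: J => J [FJ sJ]; apply: contrapT => nonext; apply: noMax.
  exists J; split=> // J' FJ' sJJ' x xJ'; apply: contrapT => xJ; apply: nonext.
  have sJ' : {subset J0 <= J'} by move=> y /sJ/sJJ'.
  by exists (exist _ J' (conj FJ' sJ')); split=> //; exists x => //; apply/negP.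
have [f fP] := choice next.
have J0J0 : {subset J0 <= J0} by [].
pose g k := iter k f (exist _ J0 (conj FJ0 J0J0)).
have g_id k : idealr_closed (sval (g k)) by apply: Fid; case: (svalP (g k)).
have g_mono i j : (i <= j)%N -> {subset sval (g i) <= sval (g j)}.
  move=> /subnKC <-; elim: (j - i)%N => [|k IHk] x; first by rewrite addn0.
  by move=> /IHk xg; rewrite addnS; have [+ _] := fP (g (i + k)%N); apply.
pose U : {pred R} := [pred x | `[< exists k, x \in sval (g k) >]].
have UP x : reflect (exists k, x \in sval (g k)) (x \in U) by apply: asboolP.
have Uid : idealr_closed U.
  split; first by apply/UP; exists 0%N; have [] := g_id 0%N.
    by apply/UP => -[k]; have [_ /negP] := g_id k.
  move=> a u v /UP[i ui] /UP[j vj]; apply/UP; exists (maxn i j).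
  have [_ _] := g_id (maxn i j); apply.
    by apply: g_mono ui; rewrite leq_maxl.
  by apply: g_mono vj; rewrite leq_maxr.
have [s [sU Us]] := noeth U Uid.
have [k sk] : exists k, {subset s <= sval (g k)}.
  elim: s sU {Us} => [|x s IHs] sU; first by exists 0%N.
  have [y sy|k sk] := IHs; first by apply: sU; rewrite inE sy orbT.
  have /UP[l xl] := sU x (mem_head _ _); exists (maxn k l) => y.
  rewrite inE => /predU1P[->|/sk yk].
    by apply: g_mono xl; rewrite leq_maxr.
  by apply: g_mono yk; rewrite leq_maxl.
have [_ [x xk /negP[]]] := fP (g k).
have /Us[c ->] : x \in U by apply/UP; exists k.+1.
have gc := proper_ideal_closed (g_id k).
elim/big_ind: _ => [|u v|i _]; first by case: gc.
  exact: ideal_closedD.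
by apply: ideal_closedZ => //; apply: sk; apply: mem_nth.
Qed.

(** The generators of the product of the ideals in the list. *)
Inductive product_of : seq {pred R} -> R -> Prop :=
| product_nil : product_of [::] 1
| product_cons P s x y :
    x \in P -> product_of s y -> product_of (P :: s) (x * y).

Lemma product_of_cat s t a :
  product_of (s ++ t) a ->
  exists u v, [/\ product_of s u, product_of t v & a = u * v].
Proof.
elim: s a => [|P s IHs] a /=.
  by exists 1, a; split=> //; [exact: product_nil | rewrite mul1r].
move=> e; inversion e as [|P' s' x y Px sy]; subst.
have [u [v [su tv ->]]] := IHs _ sy.
by exists (x * u), v; split=> //; [exact: product_cons | rewrite mulrA].
Qed.

Lemma prime_product_sub P s :
  prime_ideal P -> (forall a, product_of s a -> a \in P) ->
  exists2 Q, List.In Q s & {subset Q <= P}.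
Proof.
move=> Pp; elim: s => [|Q s IHs] sP.
  by have := sP 1 product_nil; have [[_ /negPf ->]] := Pp.
have [QP|] := pselect {subset Q <= P}; first by exists Q; [left|].
move=> /existsNP[x /not_implyP[xQ /negP xP]].
have [a sa|Q' Q's Q'P] := IHs; last by exists Q'; [right|].
have [_ pr] := Pp; have := pr _ _ (sP _ (product_cons xQ sa)).
by rewrite (negPf xP).
Qed.

(** Noetherian induction: a maximal counterexample J is proper and not prime, so
    u v is in J with u and v outside, and the lists obtained for J + (u) and
    J + (v) can be concatenated, as (J + (u)) (J + (v)) lies in J. With
    [prime_product_sub] this gives the finiteness of the set of minimal
    primes of J. *)
Lemma noetherian_prime_product J :
  noetherian R -> ideal_closed J ->
  exists s, (forall P, List.In P s -> prime_ideal P /\ {subset J <= P}) /\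
            (forall a, product_of s a -> a \in J).
Proof.
move=> noeth.
pose good J := exists s,
  (forall P, List.In P s -> prime_ideal P /\ {subset J <= P}) /\
  (forall a, product_of s a -> a \in J).
rewrite -/(good J) => Jc; apply: contrapT => Jbad.
have triv K : 1 \in K -> good K.
  by move=> K1; exists [::]; split=> // a e; inversion e.
have notin K : ~ good K -> 1 \notin K by move=> Kb; apply/negP => /triv.
have [||K [[Kc Kb] _ Kmax]] :=
  @noetherian_maximal (fun K => ideal_closed K /\ ~ good K) J noeth.
- by move=> K [Kc /notin]; apply: idealr_closedE.
- by [].
have grow x : x \notin K -> good (adjoin K x).
  move=> xK; apply: contrapT => bad; move/negP: xK; apply.
  apply: (Kmax (adjoin K x)); last by apply: mem_adjoin; case: Kc.
    by split=> //; apply: adjoin_ideal.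
  exact: sub_adjoin.
apply: (Kb); have [Kp|Knp] := pselect (prime_idealr_closed K).
  exists [:: K]; split=> [P [<-|//]|a e].
    by split=> //; split=> //; apply: idealr_closedE (notin _ Kb).
  by inversion e as [|? ? x y xK e']; inversion e'; rewrite mulr1.
have [u [v [uvK /grow[s [sP sK]] /grow[t [tP tK]]]]] :
    exists u v, [/\ u * v \in K, u \notin K & v \notin K].
  apply: contrapT => no; apply: Knp => u v uvK; apply: contrapT => /negP.
  by rewrite negb_or => /andP[uK vK]; apply: no; exists u, v.
exists (s ++ t); split=> [P Pst|a].
  by case: (List.in_app_or _ _ _ Pst) => [/sP|/tP] [Pp sub];
    split=> // x xK; apply/sub/sub_adjoin.
move=> /product_of_cat[b [c [/sK/adjoinP[j jK [r ->]] /tK/adjoinP[k kK [r' ->]] ->]]].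
rewrite mulrDl mulrDr [r * u * _]mulrDr mulrACA.
by do 2![apply: ideal_closedD => //]; rewrite 1?[j * _]mulrC; apply: ideal_closedZ.
Qed.

(** The hypothesis that the list is an antichain makes a plain induction work:
    if x in J avoids s but not P, add to it some y in J and in every ideal of s
    but not in P, which exists because no ideal of s lies in P. *)
Lemma prime_avoidance J (s : seq {pred R}) :
    ideal_closed J ->
    (forall P, List.In P s -> prime_ideal P) ->
    (forall P Q, List.In P s -> List.In Q s -> {subset Q <= P} ->
       {subset P <= Q}) ->
    (forall P, List.In P s -> ~ {subset J <= P}) ->
  exists2 x, x \in J & forall P, List.In P s -> x \notin P.
Proof.
move=> Jc; elim: s => [|P s IHs] sp anti sJ.
  by exists 0 => //; case: Jc.
have [|||x Jx sx] := IHs.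
- by move=> Q Qs; apply: sp; right.
- by move=> Q Q' Qs Q's; apply: anti; right.
- by move=> Q Qs; apply: sJ; right.
have [xP|xP] := boolP (x \in P); last first.
  by exists x => // Q [<-|/sx].
have Pp : prime_ideal P by apply: sp; left.
have [y [yJ yP sy]] : exists y,
    [/\ y \in J, y \notin P & forall Q, List.In Q s -> y \in Q].
  have sQP Q : List.In Q s -> ~ {subset Q <= P}.
    move=> Qs QP; have PQ : {subset P <= Q} by apply: anti => //; [left|right].
    by move/negP: (sx Q Qs); apply; apply: PQ.
  have {sQP IHs anti sx sJ} : (~ {subset J <= P}) /\
      forall Q, List.In Q s -> prime_ideal Q /\ ~ {subset Q <= P}.
    split; first by apply: sJ; left.
    by move=> Q Qs; split; [apply: sp; right | apply: sQP].
  move=> [/existsNP[z /not_implyP[zJ /negP zP]]].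
  elim: s {sp} => [|Q s IHs] sQ; first by exists z.
  have [|y [yJ yP sy]] := IHs; first by move=> Q' Q's; apply: sQ; right.
  have [|Qp /existsNP[c /not_implyP[cQ /negP cP]]] := sQ Q; first by left.
  exists (c * y); split; first exact: ideal_closedZ.
    exact: prime_idealM.
  move=> Q' [<-|Q's].
    by rewrite mulrC; apply: ideal_closedZ (prime_ideal_closed Qp) cQ.
  apply: ideal_closedZ (sy _ Q's).
  by have [|/prime_ideal_closed] := sQ Q'; first by right.
have cancel Q u v : prime_ideal Q -> u \in Q -> u + v \in Q -> v \in Q.
  move=> /prime_ideal_closed Qc uQ uvQ.
  by rewrite -(addKr u v) -mulN1r; case: (Qc) => _; apply.
exists (x + y); first exact: ideal_closedD.
move=> Q [<-|Qs]; first by apply: contra yP; apply: cancel.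
apply: contra (sx _ Qs); rewrite addrC; apply: cancel; last exact: sy.
by apply: sp; right.
Qed.

(** For a prime P this says that dim R / P >= k. *)
Definition coheight_ge (k : nat) P : Prop :=
  exists C, prime_chain k C /\ C 0%N =i P.

Lemma eq_prime_ideal P Q : P =i Q -> prime_ideal P -> prime_ideal Q.
Proof. by move=> PQ; rewrite (_ : P = Q) //; apply/funext => x; apply: PQ. Qed.

Lemma coheight_ge_prime k P : coheight_ge k P -> prime_ideal P.
Proof. by move=> [C [[Cp _] C0]]; apply: eq_prime_ideal C0 (Cp _ _). Qed.

Lemma coheight_ge_sub k P Q :
  prime_ideal P -> {subset P <= Q} -> coheight_ge k Q -> coheight_ge k P.
Proof.
move=> Pp PQ [C [[Cp Cs] C0]].
exists (fun i => if i is 0 then P else C i); split=> //.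
split=> [[|i] //|[|i]]; [exact: Cp| |exact: Cs].
move=> /Cs[C01 [x x1 x0]]; split=> [y yP|]; first by apply: C01; rewrite C0 PQ.
by exists x => //; apply: contra x0 => xP; rewrite C0 PQ.
Qed.

Lemma coheight_ge_proper k P Q :
  prime_ideal P -> {subset P <= Q} -> ~ {subset Q <= P} -> coheight_ge k Q ->
  coheight_ge k.+1 P.
Proof.
move=> Pp PQ QP [C [[Cp Cs] C0]].
exists (fun i => if i is j.+1 then C j else P); split=> //.
split=> [[|i] //|[|i]]; [exact: Cp| |exact: Cs].
move=> _; split=> [y yP|]; first by rewrite C0 PQ.
move: QP => /existsNP[x /not_implyP[xQ /negP xP]].
by exists x; rewrite ?C0.
Qed.

Definition coheight_eq k P : Prop := coheight_ge k P /\ ~ coheight_ge k.+1 P.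

Lemma coheight_eq_sub k P Q :
  prime_ideal Q -> ~ coheight_ge k.+1 Q -> coheight_ge k P ->
  {subset Q <= P} -> {subset P <= Q}.
Proof.
move=> Qp nQ kP QP; apply: contrapT => PQ.
exact: nQ (coheight_ge_proper Qp QP PQ kP).
Qed.

(** The bound dim R / J < k, where J may be improper. *)
Definition dim_lt (k : nat) J : Prop :=
  forall P, {subset J <= P} -> ~ coheight_ge k P.

Lemma dim_ltS k J : dim_lt k J -> dim_lt k.+1 J.
Proof.
move=> dJ P JP [C [[Cp Cs] C0]]; have [C01 _] := Cs 0%N isT.
apply: (dJ (C 1%N)) => [x /JP|]; first by rewrite -C0 => /C01.
by exists (C \o succn); split=> //; split=> i; [exact: (Cp i.+1)|exact: (Cs i.+1)].
Qed.

(** These are the top-dimensional components of the closed set V(J), when it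
    has dimension k. *)
Lemma top_primes k J :
  noetherian R -> ideal_closed J -> dim_lt k.+1 J ->
  exists s, (forall P, List.In P s -> {subset J <= P} /\ coheight_eq k P) /\
    (forall P, coheight_ge k P -> {subset J <= P} ->
       exists2 Q, List.In Q s & P =i Q).
Proof.
move=> noeth Jc dJ; have [t [tP tJ]] := noetherian_prime_product noeth Jc.
have [s sE] : exists s, forall P, List.In P s <-> List.In P t /\ coheight_ge k P.
  elim: t {tP tJ} => [|Q t [s sE]]; first by exists [::] => P; split=> [|[]].
  have [kQ|nQ] := pselect (coheight_ge k Q).
    exists (Q :: s) => P; split=> [[<-|/sE[Pt kP]]|[[<-|Pt] kP]].
    - by split=> //; left.
    - by split=> //; right.
    - by left.
    - by right; apply/sE.
  exists s => P; split=> [/sE[Pt kP]|[[QP|Pt] kP]].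
  - by split=> //; right.
  - by case: nQ; rewrite QP.
  - exact/sE.
exists s; split=> [P /sE[/tP[_ JP] kP]|P kP JP].
  by split=> //; split=> //; apply: dJ.
have [||Q Qt QP] := @prime_product_sub P t; first exact: coheight_ge_prime kP.
  by move=> a /tJ/JP.
have [Qp JQ] := tP _ Qt.
exists Q; first by apply/sE; split=> //; apply: coheight_ge_sub QP kP.
move=> x; apply/idP/idP => [xP|/QP //].
exact: coheight_eq_sub Qp (dJ Q JQ) kP QP _ xP.
Qed.

Definition colon J b : {pred R} := [pred a | a * b \in J].

(** Multiplication by b removes from V(J) its k-dimensional components that are
    not in s. Take a product of primes t inside J: b is the product of one
    element from each factor of t that is not in s, chosen outside the primes
    of s, and the product of the remaining factors lies in the ideal
    colon J b. *)
Lemma isolate_top_primes k J (s : seq {pred R}) :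
    noetherian R -> ideal_closed J -> dim_lt k.+1 J ->
    (forall P, List.In P s -> coheight_eq k P) ->
  exists b, (forall P, List.In P s -> b \notin P) /\
    (forall P, coheight_ge k P -> {subset colon J b <= P} ->
       exists2 Q, List.In Q s & P =i Q).
Proof.
move=> noeth Jc dJ sk.
have sp P : List.In P s -> prime_ideal P by move=> /sk[/coheight_ge_prime].
have [t [tP tJ]] := noetherian_prime_product noeth Jc.
have tdim Q P : List.In Q t -> coheight_ge k P -> {subset Q <= P} -> P =i Q.
  move=> /tP[Qp JQ] kP QP x; apply/idP/idP => [xP|/QP //].
  exact: coheight_eq_sub Qp (dJ Q JQ) kP QP _ xP.
have [b [t' [bs t't bt']]] : exists b t',
    [/\ forall P, List.In P s -> b \notin P,
        forall Q, List.In Q t' -> List.In Q t /\ exists2 P, List.In P s & P =i Q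
      & forall a, product_of t' a -> product_of t (b * a)].
  elim: t {tJ} tP tdim => [|Q t IHt] tP tdim.
    exists 1, [::]; split=> // [P /sp[[]] //|a].
    by rewrite mul1r.
  have [|Q' P Q't|b [t' [bs t't bt']]] := IHt.
  - by move=> P Pt; apply: tP; right.
  - by apply: tdim; right.
  have [Qs|Qs] := pselect (exists2 P, List.In P s & P =i Q).
    exists b, (Q :: t'); split=> //.
      move=> Q' [<-|/t't[Q't ?]]; split=> //; [by left|by right].
    move=> a e; inversion e as [|? ? x y xQ yt']; subst.
    by rewrite mulrCA; apply: product_cons => //; apply: bt'.
  have [||P P' /sk[kP _] /[dup] /sp P'p /sk[_ P'k]|P Ps QP|c cQ cs] :=
      @prime_avoidance Q s => //.
  - by have [|/prime_ideal_closed] := tP Q; first left.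
  - exact: coheight_eq_sub kP.
  - by apply: Qs; exists P => //; apply: tdim => //; [left|case: (sk _ Ps)].
  exists (c * b), t'; split.
  - by move=> P Ps; apply: prime_idealM; [apply: sp | apply: cs | apply: bs].
  - by move=> Q' /t't[Q't ?]; split=> //; right.
  - by move=> a /bt' ba; rewrite -mulrA; apply: product_cons.
exists b; split=> // P kP bP.
have [||Q Qt' QP] := @prime_product_sub P t'; first exact: coheight_ge_prime kP.
  by move=> a /bt'/tJ baJ; apply: bP; rewrite inE mulrC.
have [Qt [P' P's P'Q]] := t't _ Qt'; exists P' => // x.
by rewrite P'Q; apply: tdim.
Qed.

End Primes.

(** * Annihilators and division in injective modules *)

Section Annihilators.
Variables (R : comNzRingType) (E : lmodType R).
Implicit Types e : E.

Definition ann e : {pred R} := [pred a | a *: e == 0].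

Lemma annP a e : reflect (a *: e = 0) (a \in ann e).
Proof. exact: eqP. Qed.

Lemma ann_ideal e : ideal_closed (ann e).
Proof.
split=> [|a u v /annP ue /annP ve]; apply/annP; first by rewrite scale0r.
by rewrite scalerDl -scalerA ue ve scaler0 addr0.
Qed.

Lemma sub_annZ a e : {subset ann e <= ann (a *: e)}.
Proof.
move=> b /annP be; apply/annP.
by rewrite scalerA mulrC -scalerA be scaler0.
Qed.

(** Take N such that ann (x^N e) = ann (x^(N+1) e). Then
    j + r x^(N+1) |-> r x^N e is a well-defined linear map on the ideal
    ann e + (x^(N+1)), and e' is an element by which it multiplies. Hence
    multiplication by x is onto up to x-torsion, without enlarging supports. *)
Lemma injective_divide_up_to_torsion e x :
    noetherian R -> injective_module E ->
  exists N e', {subset ann e <= ann e'} /\ x ^+ N.+1 *: e' = x ^+ N *: e.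
Proof.
move=> noeth Einj.
have [[N xe0]|xne] := pselect (exists N, x ^+ N *: e = 0).
  by exists N, 0; rewrite xe0 scaler0; split=> // a _; apply/annP/scaler0.
have [N stab] : exists N, forall a, a * x ^+ N.+1 *: e = 0 -> a * x ^+ N *: e = 0.
  have [|| J [[N ->] _ Jmax]] := @noetherian_maximal R
      (fun J => exists N, J = ann (x ^+ N *: e)) (ann (x ^+ 0 *: e)) noeth.
  - move=> _ [N ->]; apply: idealr_closedE (ann_ideal _) _.
    by apply/annP; rewrite scale1r => xe; apply: xne; exists N.
  - by exists 0%N.
  exists N => a; rewrite -!scalerA => /annP ax; apply/annP.
  apply: Jmax ax; first by exists N.+1.
  by rewrite exprS -scalerA; apply: sub_annZ.
pose G (u : R^o * E) := exists j r, [/\ j *: e = 0, u.1 = j + r * x ^+ N.+1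
  & u.2 = r *: (x ^+ N *: e)].
have [||f [j [r [je f0 /= ->]]]|e' e'E] := injective_extend_graph Einj (G := G).
- by exists 0, 0; rewrite /= mul0r addr0 !scale0r.
- move=> a [_ _] [_ _] [j [r [/= je -> ->]]] [k [s [/= ke -> ->]]].
  exists (a * j + k), (a * r + s); split=> /=.
  + by rewrite scalerDl -scalerA je ke scaler0 addr0.
  + by rewrite /GRing.scale /= mulrDr mulrDl mulrA addrACA.
  + by rewrite scalerDl !scalerA mulrA.
- rewrite scalerA; apply: stab; move: f0 => /= /esym/eqP.
  by rewrite addr_eq0 => /eqP jE; rewrite -[_ * _]opprK -jE scaleNr je oppr0.
exists N, e'; split=> [a /annP ae|].
  by apply/annP; rewrite -(e'E a 0) //; exists a, 0; rewrite mul0r addr0 scale0r.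
by rewrite -(e'E (x ^+ N.+1) (x ^+ N *: e)) //; exists 0, 1; 
  rewrite scale0r add0r mul1r scale1r.
Qed.

End Annihilators.

(** * Vanishing by descending induction on the dimension of supports *)

Section Vanishing.
Variables (R : idomainType) (n : nat).
Hypotheses (R_noeth : noetherian R) (R_dim : has_krull_dim R n).

Lemma zero_ideal_prime : prime_ideal (pred1 (0 : R)).
Proof.
split=> [|u v]; last by rewrite !inE mulf_eq0.
split; rewrite ?inE ?oner_eq0 // => a u v /eqP-> /eqP->.
by rewrite inE mulr0 addr0.
Qed.

Lemma coheight_le k (P : {pred R}) : coheight_ge k P -> (k <= n)%N.
Proof. by case=> C [Cch _]; case: R_dim => _; apply; apply: Cch. Qed.

(** In a domain of dimension n the zero ideal is the only prime of coheight n,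
    because a nonzero prime of coheight n would give it coheight n + 1. *)
Lemma torsion_dim_ltP (E : lmodType R) (e : E) :
  dim_lt n (ann e) <-> exists2 r, r != 0 & r *: e = 0.
Proof.
split=> [de|[r r0 /annP re] P eP nP].
  apply: contrapT => notors; have [[C Cch] _] := R_dim.
  apply: (de (C 0%N)); last by exists C.
  move=> a /annP ae; have [->|a0] := eqVneq a 0; last by case: notors; exists a.
  by case: Cch => /(_ 0%N isT) /prime_ideal_closed[].
have /coheight_le : coheight_ge n.+1 (pred1 (0 : R)); last by rewrite ltnn.
apply: (coheight_ge_proper zero_ideal_prime _ _ nP).
  by move=> _ /eqP->; case: (prime_ideal_closed (coheight_ge_prime nP)).
by move=> /(_ r (eP _ re)); rewrite inE (negPf r0).
Qed.

Variables (M : lmodType R) (I : injective_resolution M).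
Hypothesis M_torsion : forall x : M, exists2 r, r != 0 & r *: x = 0.

(** Vanishing of the cohomology of the sections of I with support of dimension
    less than k, in the degrees i + 1 > n - k. *)
Definition supported_cohomology_eq0 k : Prop :=
  forall i (z : res_mod I i.+1), (n <= i + k)%N -> dim_lt k (ann z) ->
  res_diff I i.+1 z = 0 -> exists2 y, dim_lt k (ann y) & z = res_diff I i y.

Lemma res_diffK i y : res_diff I i.+1 (res_diff I i y) = 0.
Proof. by apply/res_exactS; exists y. Qed.

Lemma torsion_cohomology_eq0 : supported_cohomology_eq0 n.
Proof.
move=> i z _ /torsion_dim_ltP[r r0 rz] /res_exactS[y zy].
suff [y' [s s0 sy'] dy'] : exists2 y',
    (exists2 s, s != 0 & s *: y' = 0) & res_diff I i y' = z.
  by exists y' => //; apply/torsion_dim_ltP; exists s.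
have : res_diff I i (r *: y) = 0 by rewrite linearZ /= -zy.
(* In degree 0 the cocycle r y comes from M, and is torsion for this reason. *)
case: i => [|i] in z rz y zy *.
  move=> /res_exact0[x ryx]; have [s s0 sx] := M_torsion x.
  exists y => //; exists (s * r); first by rewrite mulf_neq0.
  by rewrite -scalerA ryx -linearZ sx linear0.
move=> /res_exactS[w ryw].
have [N [w' [_ w'E]]] :=
  injective_divide_up_to_torsion w r R_noeth (@res_injective _ _ I i).
exists (y - res_diff I i w'); last by rewrite linearB res_diffK subr0.
exists (r ^+ N.+1); first by rewrite expf_neq0.
by rewrite scalerBr -linearZZ w'E linearZZ exprSr -scalerA ryw subrr.
Qed.

(** The hypothesis k < n forces the degree i + 1 to be at least 2, so that the
    cocycle x y of degree i is a coboundary by the induction hypothesis. *)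
Lemma supported_cohomology_step k :
  (k < n)%N -> supported_cohomology_eq0 k.+1 -> supported_cohomology_eq0 k.
Proof.
move=> kn vanS i z nik dz zc.
have [||y dy zy] := vanS i z _ _ zc; first by rewrite addnS leqW.
  exact: dim_ltS.
have [s [sP sT]] := top_primes R_noeth (ann_ideal y) dy.
have sp P : List.In P s -> prime_ideal P by move=> /sP[_ [/coheight_ge_prime]].
have [||x /annP xz xs] :=
    prime_avoidance (ann_ideal z) sp.
- move=> P Q /sP[_ [kP _]] /[dup]/sp Qp /sP[_ [_ nQ]].
  exact: coheight_eq_sub kP.
- by move=> P /sP[_ [kP _]] /dz.
case: i => [|i] in z nik dz zc y dy zy sP sT xz *.
  by move: nik; rewrite add0n leqNgt kn.
have dxy : res_diff I i.+1 (x *: y) = 0 by rewrite linearZ /= -zy.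
have dimxy : dim_lt k.+1 (ann (x *: y)).
  by move=> P sub; apply: dy => a /(sub_annZ x)/sub.
have [|w dw xyw] := vanS i (x *: y) _ dimxy dxy; first by rewrite addnS -addSn.
have [b [bs bT]] := isolate_top_primes R_noeth (ann_ideal w) dw
  (fun P Ps => (sP P Ps).2).
have [N [w' [w'w w'E]]] := injective_divide_up_to_torsion (b *: w) (b * x)
  R_noeth (@res_injective _ _ I i).
exists (y - res_diff I i w'); last by rewrite linearB res_diffK subr0.
(* A prime P of coheight at least k over ann (y - d w') contains ann y or
   ann (b w), hence is one of the primes in s; but it contains b x. *)
move=> P sub kP; have Pp := coheight_ge_prime kP.
have [Q Qs PQ] : exists2 Q, List.In Q s & P =i Q.
  have [/(sT _ kP) //|/existsNP[u /not_implyP[/annP uy uP]]] :=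
    pselect {subset ann y <= P}.
  apply: bT => // v vb; have /annP vw : v \in ann w'.
    by apply: w'w; apply/annP; rewrite scalerA; apply/annP.
  apply: contrapT => /negP vP; move/negP: uP => uP.
  have /negP := prime_idealM Pp uP vP; apply; apply: sub; apply/annP.
  rewrite scalerBr mulrC -[in X in X - _]scalerA uy scaler0 sub0r.
  by rewrite mulrC -linearZZ -scalerA vw scaler0 linear0 oppr0.
have bxP : b * x \notin P.
  by rewrite PQ; apply: prime_idealM; [apply: sp | apply: bs | apply: xs].
move/negP: bxP; apply; apply: (prime_idealX (k := N.+1)) Pp _.
apply: sub; apply/annP; rewrite scalerBr -linearZZ w'E.
have bxy : (b * x) *: y = res_diff I i (b *: w) by rewrite -scalerA xyw linearZZ.
by rewrite linearZZ exprSr -scalerA bxy subrr.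
Qed.

Lemma support_closed_point_cohomology_eq0 : (0 < n)%N -> supported_cohomology_eq0 1.
Proof.
suff van j : (j < n)%N -> supported_cohomology_eq0 (n - j).
  move=> n0; have := van n.-1; rewrite -subn1 subKn //; apply.
  by rewrite subn1 ltn_predL.
elim: j => [|j IHj] jn; first by rewrite subn0; apply: torsion_cohomology_eq0.
apply: supported_cohomology_step; first by rewrite ltn_subrL //= (leq_ltn_trans _ jn).
by rewrite -subSn ?subSS 1?ltnW //; apply: IHj; apply: ltnW.
Qed.

End Vanishing.

(** * Sections supported at the closed point *)

Section LocalRing.
Variables (R : comNzRingType) (m : {pred R}).
Hypothesis R_local : local_ring m.

Let noeth : noetherian R. Proof. by case: R_local. Qed.
Let m_max : maximal_ideal m. Proof. by case: R_local. Qed.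

Lemma proper_sub_max J : idealr_closed J -> {subset J <= m}.
Proof.
move=> Jid; have [//|K [Kid JK Kmax]] := noetherian_maximal noeth _ Jid.
have [_ _ m_uniq] := R_local; move=> x Jx; rewrite -(m_uniq K); first exact: JK.
by split=> // J' J'id KJ' y; apply/idP/idP => [|/KJ'//]; apply: Kmax.
Qed.

Lemma max_ideal_prime : prime_ideal m.
Proof.
have [mid mM] := m_max; have mc := proper_ideal_closed mid.
split=> // u v uv; apply/orP; have [um|um] := boolP (u \in m); first by left.
right; have : 1 \in adjoin m u.
  apply: contrapT => /negP n1; move/negP: um; apply.
  apply: (proper_sub_max (idealr_closedE (adjoin_ideal u mc) n1)).
  by apply: mem_adjoin; case: mc.
move=> /adjoinP[j jm [r jE]]; rewrite -[v]mulr1 jE mulrDr.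
by apply: ideal_closedD => //; rewrite 1?mulrCA ?[v * u]mulrC ideal_closedZ.
Qed.

(** If dim R / ann e < 1, all the primes over ann e are m, and a product of
    them lies in ann e, hence so does a power of m. *)
Lemma in_GammaP (E : lmodType R) (e : E) :
  in_Gamma m e <-> dim_lt 1 (ann e).
Proof.
split=> [[k ke] P eP [C [[Cp Cs] C0]]|de].
  have Pp := eq_prime_ideal C0 (Cp 0%N isT).
  have mP : {subset m <= P}.
    move=> x xm; apply: (prime_idealX (k := k)) Pp _; apply/eP/annP/ke.
    exists 1%N, (fun=> 1), (fun _ _ => x); split=> //.
    by rewrite big_ord1 mul1r prodr_const card_ord.
  have [C01 [x x1 /negP[]]] := Cs 0%N isT.
  have [[C1id _] _] := (Cp 1%N isT, tt).
  by rewrite C0 mP // (proper_sub_max C1id).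
have [s [sP se]] := noetherian_prime_product noeth (ann_ideal e).
have sm P : List.In P s -> {subset m <= P}.
  move=> /sP[Pp eP]; apply: contrapT => mP; apply: (de P eP).
  apply: (coheight_ge_proper Pp _ mP); first by apply: proper_sub_max; case: Pp.
  by exists (fun=> m); split=> //; split=> // i _; apply: max_ideal_prime.
exists (size s) => _ [N [c [y [ym ->]]]]; apply/annP.
have ec := ann_ideal e.
elim/big_ind: _ => [|u v|i _]; [by case: ec|exact: ideal_closedD|].
apply: ideal_closedZ => //; apply: {ec} se.
move: (y i) (ym i) => {c y ym i}.
elim: s {sP} sm => [|P s IHs] sm z zm.
  by rewrite big_ord0; apply: product_nil.
rewrite big_ord_recl; apply: product_cons; first by apply: sm (zm _); left.
by apply: IHs => // Q Qs; apply: sm; right.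
Qed.

End LocalRing.

(** In dimension 0 the ring is a field, over which torsion modules are zero. *)
Lemma torsion_top_cohomology_eq0 (R : idomainType) (m : {pred R}) n
    (M : lmodType R) :
    local_ring m -> has_krull_dim R n ->
    (forall x : M, exists2 r, r != 0 & r *: x = 0) ->
  local_cohomology_eq0 m n M.
Proof.
move=> Rm Rn Mt I; have [noeth [mid _] _] := Rm.
case: n => [|n] in Rn * => x.
  move=> _ /res_exact0[y ->]; have [r r0 ry] := Mt y.
  suff r_unit : r \is a GRing.unit.
    by rewrite -[y]scale1r -(mulVr r_unit) -scalerA ry scaler0 linear0.
  have m0 z : z \in m -> z = 0.
    move=> zm; apply: contrapT => /eqP z0.
    have /(coheight_le Rn) : coheight_ge 1 (pred1 (0 : R)); last by [].
    apply: (@coheight_ge_proper _ 0 _ m); first exact: zero_ideal_prime.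
    - by move=> _ /eqP->; case: mid.
    - by move=> /(_ z zm); rewrite inE (negPf z0).
    by exists (fun=> m); split=> //; split=> // i _; apply: max_ideal_prime.
  apply: contrapT => /negP r_nunit; move/eqP: r0; apply; apply: m0.
  have c0 := proper_ideal_closed (zero_ideal_prime R).1.
  apply: (proper_sub_max Rm (J := adjoin (pred1 0) r)).
    apply: idealr_closedE (adjoin_ideal _ c0) _; apply/adjoinP.
    move=> [_ /eqP-> [s]]; rewrite add0r => /esym sr.
    by move/negP: r_nunit; apply; apply/unitrPr; exists s; rewrite mulrC.
  by apply: mem_adjoin; case: c0.
move=> /(in_GammaP Rm) dx xc.
have [||y dy xy] := support_closed_point_cohomology_eq0 noeth Rn Mt _ _ dx xc => //.
  by rewrite addn1.
by exists y => //; apply/(in_GammaP Rm).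
Qed.

(** * Kaehler differentials of a separable integral extension are torsion *)

Lemma clear_denominators (R : idomainType) (p : {poly {fraction R}}) :
  exists c (q : {poly R}),
    c != 0 /\ map_poly (@FracField.tofrac R) q = (FracField.tofrac c) *: p.
Proof.
elim/poly_ind: p => [|p a [c [q [c0 qE]]]].
  by exists 1, 0; rewrite oner_eq0 rmorph0 scaler0.
pose b := \d_(repr a); have b0 : b != 0 by apply: denom_ratioP.
exists (c * b), (b *: q * 'X + (c * \n_(repr a))%:P); rewrite mulf_neq0 //.
split=> //; rewrite rmorphD rmorphM /= map_polyX map_polyC map_polyZ qE /=.
have bE : (FracField.tofrac (c * \n_(repr a))) = FracField.tofrac (c * b) * a.
  rewrite !tofracM -mulrA; congr (_ * _).
  by rewrite [X in _ = _ * X]frac_repr mulrCA divff ?tofrac_eq0 // mulr1.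
rewrite scalerDr bE polyCM mul_polyC; congr (_ + _).
by rewrite -!scalerAl scalerA -tofracM [b * c]mulrC.
Qed.

Section Torsion.
Variables (R A : idomainType) (phi : {rmorphism R -> A}).
Hypothesis phi_inj : injective phi.

(** Clear the denominators of a separable polynomial p over the fraction field
    that kills a: as p is coprime to p', it has no root in common with p'. *)
Lemma separable_annihilating_poly (a : A) :
    separable_algebraic (frac_map phi_inj) ->
  exists q : {poly R}, root (map_poly phi q) a /\ (map_poly phi q)^`().[a] != 0.
Proof.
move=> /(_ (FracField.tofrac a))[p [_ p_sep pa]].
have [c [q [c0 qE]]] := clear_denominators p.
have cF0 : frac_map phi_inj (FracField.tofrac c) != 0.
  by rewrite frac_map_tofrac tofrac_eq0 -(rmorph0 phi) (inj_eq phi_inj).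
have mapE : map_poly (@FracField.tofrac A) (map_poly phi q) =
    frac_map phi_inj (FracField.tofrac c) *: map_poly (frac_map phi_inj) p.
  rewrite -map_polyZ -qE -!map_poly_comp; apply: eq_map_poly => r /=.
  by rewrite frac_map_tofrac.
exists q; split.
  by rewrite /root -tofrac_eq0 -horner_map mapE hornerZ (eqP pa) mulr0.
rewrite -tofrac_eq0 -horner_map -deriv_map mapE derivZ hornerZ; apply: mulf_neq0 => //.
have {}p_sep : separable_poly (map_poly (frac_map phi_inj) p).
    by rewrite separable_map.
by have := p_sep; rewrite unlock => /coprimep_root; apply.
Qed.

(** An equation satisfied by a can be divided by a until its constant term c is
    nonzero; then a divides c. *)
Lemma integral_multiple (a : A) :
  integralOver phi a -> a != 0 -> exists2 r, r != 0 & exists b, b * a = phi r.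
Proof.
move=> [p p_monic pa] a0; have p0 := monic_neq0 p_monic.
elim/poly_ind: p {p_monic} p0 pa => [|p c IHp]; first by rewrite eqxx.
have [->|c0] := eqVneq c 0.
  rewrite addr0 mulf_eq0 negb_or => /andP[p0 _].
  by rewrite rmorphM /= map_polyX rootM rootX (negPf a0) orbF; apply: IHp.
move=> _; rewrite rmorphD rmorphM /= map_polyX map_polyC /root !hornerE.
rewrite addr_eq0 => /eqP pa; exists (- c); first by rewrite oppr_eq0.
by exists (map_poly phi p).[a]; rewrite rmorphN.
Qed.

Section Derivations.
Variables (M : lmodType A) (d : A -> M).
Hypothesis d_der : derivation phi d.

Lemma derivation_poly (q : {poly R}) a :
  d (map_poly phi q).[a] = (map_poly phi q)^`().[a] *: d a.
Proof.
have [dD dM dphi] := d_der.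
elim/poly_ind: q => [|q c IHq].
  by rewrite rmorph0 deriv0 !horner0 scale0r -(rmorph0 phi) dphi.
rewrite rmorphD rmorphM /= map_polyX map_polyC derivD derivM derivX derivC !hornerE.
by rewrite dD dphi addr0 dM IHq scalerDl !scalerA addrC mulrC.
Qed.

End Derivations.

Variables (Omega : lmodType A) (d : A -> Omega).
Hypothesis Omega_kaehler : kaehler_differentials phi d.

Definition torsion : {pred Omega} :=
  [pred x | `[< exists2 r, r != 0 & phi r *: x = 0 >]].

Lemma torsion_closed : GRing.submod_closed torsion.
Proof.
split; first by apply/asboolP; exists 1; rewrite ?oner_eq0 ?scaler0.
move=> a x y /asboolP[r r0 rx] /asboolP[s s0 sy].
apply/asboolP; exists (r * s); first by rewrite mulf_neq0.
rewrite rmorphM scalerDr -[X in _ + X]scalerA sy scaler0 addr0.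
by rewrite scalerA -mulrA mulrC -scalerA rx scaler0.
Qed.

Let T : lmodType A := submodule torsion_closed.

(** The universal derivation d factors through the torsion submodule T, so
    there is a linear map g from Omega to T with g (d a) = d a. Followed by the
    inclusion of T it is the identity of Omega, by uniqueness. *)
Lemma kaehler_torsion (A_integral : integralRange phi)
  (A_separable : separable_algebraic (frac_map phi_inj)) (x : Omega) :
  exists2 r, r != 0 & phi r *: x = 0.
Proof.
have [d_der d_univ] := Omega_kaehler; have [dD dM dphi] := d_der.
have dT a : d a \in closed_pred torsion_closed.
  have [q [qa dqa]] := separable_annihilating_poly a A_separable.
  have [r r0 [b br]] := integral_multiple (A_integral _) dqa.
  apply/asboolP; exists r => //; rewrite -br -scalerA -(derivation_poly d_der).
  by rewrite (eqP qa) -(rmorph0 phi) dphi scaler0.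
pose D a : T := Submodule (dT a).
have [|g [gd _]] := d_univ T D.
  split=> [a b|a b|r]; apply: val_inj.
  - exact: dD.
  - exact: dM.
  - exact: dphi.
have [h [hd h_uniq]] := d_univ Omega d d_der.
have vg_lin : linear (fun y => val (g y)).
  by move=> a u v; rewrite linearP (linearP (val : T -> _)).
pose vg : {linear Omega -> Omega} := HB.pack (fun y => val (g y))
  (GRing.isLinear.Build A Omega Omega *:%R _ vg_lin).
have vgE : vg =1 h by apply: h_uniq => a; rewrite /= gd.
have idE : idfun =1 h by apply: (h_uniq idfun).
have <- : val (g x) = x by rewrite -[RHS]/(idfun x) idE -vgE.
exact/asboolP/(valP (g x)).
Qed.

End Torsion.

Theorem mainTheorem14
  (R : idomainType) (m : {pred R}) (n : nat)
  (R_local : local_ring m)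
  (R_complete : adically_complete m)
  (R_normal : normal_domain R)
  (R_dim : has_krull_dim R n)
  (A : idomainType) (phi : {rmorphism R -> A})
  (phi_inj : injective phi)
  (A_integral : integralRange phi)
  (A_separable : separable_algebraic (frac_map phi_inj))
  (Omega : lmodType A) (d : A -> Omega)
  (Omega_kaehler : kaehler_differentials phi d) :
  local_cohomology_eq0 m n (restrict_scalars phi Omega).
Proof.
apply: torsion_top_cohomology_eq0 => // x.
exact: (kaehler_torsion Omega_kaehler A_integral A_separable x).
Qed.
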